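(* Consider a radial network with the data, the relaxed modified problem SOCP-m, and the leaf-path notation defined in the context. Assume that $f_0$ is strictly increasing, and that $\overline{p}_i,\overline{q}_i\in\mathbb{R}$ ($i\in\mathcal{N}^+$) are such that $\mathcal{S}_i\subseteq\{s\in\mathbb{C}\mid \mathrm{Re}(s)\le\overline{p}_i,\ \mathrm{Im}(s)\le\overline{q}_i\}$ for all $i\in\mathcal{N}^+$. Let $u_i\in\mathbb{R}^2$ and $\underline{A}_i\in\mathbb{R}^{2\times 2}$ ($i\in\mathcal{N}^+$) be defined from these data as in the context. Suppose that (C1) $\underline{A}_{l_s}\underline{A}_{l_{s+1}}\cdots\underline{A}_{l_{t-1}}u_{l_t}>0$ (componentwise) for every leaf $l\in\mathcal{L}$ and all integers $s,t$ with $1\le s\le t\le n_l$ (for $s=t$ the expression is $u_{l_t}$). Then SOCP-m is exact, i.e., every optimal solution $(s,S,v,\ell,s_0)$ of SOCP-m satisfies $\ell_{ij}=|S_{ij}|^2/v_i$ for all $(i,j)\in\mathcal{E}$.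
   Context: Network. Let $n\ge 1$, $\mathcal{N}=\{0,1,\dots,n\}$ (buses), $\mathcal{N}^+=\mathcal{N}\setminus\{0\}$. The network is a tree on $\mathcal{N}$ rooted at bus $0$. Each line is an ordered pair $(i,j)$ of adjacent buses where $j$ lies on the unique path from $i$ to $0$; thus each $i\in\mathcal{N}^+$ has exactly one line $(i,j)$ leaving it. $\mathcal{E}$ is the set of lines, and $i\to j$ means $(i,j)\in\mathcal{E}$. $\mathcal{P}_i$ denotes the path from $i$ to $0$ (the collection of its buses, including $i$ and $0$, and of its lines). Each line has impedance $z_{ij}=r_{ij}+\mathbf{i}x_{ij}$ with $r_{ij}>0$, $x_{ij}>0$ ($\mathbf{i}$ is the imaginary unit). The squared substation voltage magnitude $v_0\geq 0$ is a given constant. For $i\in\mathcal{N}^+$ voltage bounds $\underline{v}_i,\overline{v}_i$ are given with $\underline{v}_i>0$, and $\mathcal{S}_i\subseteq\mathbb{C}$ is a given set (not necessarily convex or connected). For $i\in\mathcal{N}$, $f_i:\mathbb{R}\to\mathbb{R}$ is a given function (not necessarily convex). Lossless quantities. For $s=p+\mathbf{i}q\in\mathbb{C}^n$ ($p,q\in\mathbb{R}^n$) and $(i,j)\in\mathcal{E}$: $\hat S_{ij}(s)=\sum_{h:\,i\in\mathcal{P}_h}s_h$, $\hat P_{ij}(p)=\sum_{h:\,i\in\mathcal{P}_h}p_h$, $\hat Q_{ij}(q)=\sum_{h:\,i\in\mathcal{P}_h}q_h$; for $i\in\mathcal{N}$: $\hat v_i(s)=v_0+2\sum_{(j,k)\in\mathcal{P}_i}\mathrm{Re}(\bar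 z_{jk}\hat S_{jk}(s))$. Variables. $s=(s_i)_{i\in\mathcal{N}^+}\in\mathbb{C}^n$, $S=(S_{ij})_{(i,j)\in\mathcal{E}}$ complex, $v=(v_i)_{i\in\mathcal{N}^+}$ real, $\ell=(\ell_{ij})_{(i,j)\in\mathcal{E}}$ real, $s_0\in\mathbb{C}$. SOCP-m is the problem: minimize $\sum_{i\in\mathcal{N}}f_i(\mathrm{Re}(s_i))$ over $(s,S,v,\ell,s_0)$ subject to - $S_{ij}=s_i+\sum_{h:\,h\to i}(S_{hi}-z_{hi}\ell_{hi})$ for all $(i,j)\in\mathcal{E}$; - $0=s_0+\sum_{h:\,h\to 0}(S_{h0}-z_{h0}\ell_{h0})$; - $v_i-v_j=2\mathrm{Re}(\bar z_{ij}S_{ij})-|z_{ij}|^2\ell_{ij}$ for all $(i,j)\in\mathcal{E}$; - $\ell_{ij}\ge |S_{ij}|^2/v_i$ for all $(i,j)\in\mathcal{E}$; - $s_i\in\mathcal{S}_i$, $\underline{v}_i\le v_i$, and $\hat v_i(s)\le\overline{v}_i$ for all $i\in\mathcal{N}^+$. (It relaxes the modified optimal power flow problem OPF-m, which has $\ell_{ij}=|S_{ij}|^2/v_i$ in place of the inequality.) A ''solution'' means a global minimizer. Matrices. With $a^+=\max\{a,0\}$, $I$ the $2\times2$ identity, $\overline{p}=(\overline{p}_i)_{i\in\mathcal{N}^+}$, $\overline{q}=(\overline{q}_i)_{i\in\mathcal{N}^+}$, and $(i,j)$ the unique line leaving $i\in\mathcal{N}^+$: $u_i=\begin{pmatrix}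 r_{ij} \\ x_{ij} \end{pmatrix}$ and $\underline{A}_i=I-\frac{2}{\underline{v}_i}\begin{pmatrix} r_{ij} \\ x_{ij} \end{pmatrix}\begin{pmatrix}\hat P_{ij}(\overline{p})^+ & \hat Q_{ij}(\overline{q})^+\end{pmatrix}$. Leaves. $\mathcal{L}=\{l\in\mathcal{N}\mid \nexists k\in\mathcal{N}: k\to l\}$. For $l\in\mathcal{L}$, $n_l+1$ is the number of buses on $\mathcal{P}_l$, and $\mathcal{P}_l$ is written $l_{n_l}\to l_{n_l-1}\to\cdots\to l_1\to l_0$ with $l_{n_l}=l$, $l_0=0$. *)

(* Defs.v *)
From HB Require Import structures.
From mathcomp Require Import all_boot all_order all_algebra.
From mathcomp Require Import boolp classical_sets reals.
From mathcomp Require Import complex.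

Set Implicit Arguments.
Unset Strict Implicit.
Unset Printing Implicit Defensive.

Import Order.TTheory GRing.Theory Num.Theory.
Local Open Scope ring_scope.
Local Open Scope classical_set_scope.
Local Open Scope complex_scope.

(* Quantities indexed by the nonzero buses (resp. by the lines) are total
   functions on 'I_n.+1 (resp. on pairs of buses); their values elsewhere occur
   in no constraint and no objective. *)

Section Tree.
Variable n : nat.
Variable adj : rel 'I_n.+1.

Definition is_tree : Prop :=
  [/\ symmetric adj, irreflexive adj,
      forall i j, connect adj i j
    & forall c : seq 'I_n.+1, cycle adj c -> uniq c -> (size c < 3)%N].

Definition root_path_spec (i : 'I_n.+1) (p : seq 'I_n.+1) : Prop :=
  [/\ path adj i p, last i p = ord0 & uniq (i :: p)].

(* The buses of P_i in the order met from i to 0, both ends included.  In a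
   tree exactly one p satisfies root_path_spec. *)
Definition root_path (i : 'I_n.+1) : seq 'I_n.+1 :=
  i :: xget [::] [set p | root_path_spec i p].

Definition root_lines (i : 'I_n.+1) : seq ('I_n.+1 * 'I_n.+1) :=
  zip (root_path i) (behead (root_path i)).

Definition line (i j : 'I_n.+1) : bool := adj i j && (j \in root_path i).

(* The end of the unique line leaving i; junk for i = 0. *)
Definition parent (i : 'I_n.+1) : 'I_n.+1 := odflt ord0 [pick j | line i j].

Definition leaf (l : 'I_n.+1) : bool := ~~ [exists k, line k l].

Definition depth (l : 'I_n.+1) : nat := (size (root_path l)).-1.

(* l_m for 0 <= m <= n_l, counted from the root: l_0 = 0 and l_(n_l) = l. *)
Definition path_bus (l : 'I_n.+1) (m : nat) : 'I_n.+1 :=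
  nth ord0 (rev (root_path l)) m.

(* x_i summed over the subtree of i; for i <> 0 with line (i, j) this is
   \hat S_ij(s), \hat P_ij(p) or \hat Q_ij(q) according to the choice of x. *)
Definition subtree_sum (V : nmodType) (x : 'I_n.+1 -> V) (i : 'I_n.+1) : V :=
  \sum_(h | i \in root_path h) x h.

End Tree.

(* vsub is v_0; like vmin and vmax it is a squared voltage magnitude.
   Re and Im are qualified because the name Re alone may denote Num.Re, which is
   complex valued. *)
Record network (R : realType) (n : nat) := Network {
  adj : rel 'I_n.+1;
  adj_tree : is_tree adj;
  imp : 'I_n.+1 -> 'I_n.+1 -> R[i];
  r_gt0 : forall i j, line adj i j -> 0 < complex.Re (imp i j);
  x_gt0 : forall i j, line adj i j -> 0 < complex.Im (imp i j);
  vsub : R;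
  vsub_ge0 : 0 <= vsub;
  vmin : 'I_n.+1 -> R;
  vmin_gt0 : forall i, i != ord0 -> 0 < vmin i;
  vmax : 'I_n.+1 -> R;
  inj_set : 'I_n.+1 -> set R[i];
  cost : 'I_n.+1 -> R -> R
}.

(* sinj 0 is the variable s_0, and vsq 0 is pinned to the given constant v_0 by
   the constraints; flow i j is S_ij. *)
Record point (R : realType) (n : nat) := Point {
  sinj : 'I_n.+1 -> R[i];
  flow : 'I_n.+1 -> 'I_n.+1 -> R[i];
  vsq : 'I_n.+1 -> R;
  ell : 'I_n.+1 -> 'I_n.+1 -> R
}.

Section SOCPm.
Variables (R : realType) (n : nat) (G : network R n).

Local Notation "i --> j" := (line (adj G) i j) (at level 70).
Local Notation z := (imp G).
Local Notation normc := ComplexField.Normc.normc.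

Definition vhat (s : 'I_n.+1 -> R[i]) (i : 'I_n.+1) : R :=
  vsub G + 2 * \sum_(jk <- root_lines (adj G) i)
                 complex.Re (conjc (z jk.1 jk.2) * subtree_sum (adj G) s jk.1).

Record feasible (w : point R n) : Prop := Feasible {
  balance : forall i j, i --> j ->
    flow w i j =
      sinj w i + \sum_(h | h --> i) (flow w h i - z h i * (ell w h i)%:C);
  balance0 :
    0 = sinj w ord0
        + \sum_(h | h --> ord0) (flow w h ord0 - z h ord0 * (ell w h ord0)%:C);
  v_sub : vsq w ord0 = vsub G;
  v_drop : forall i j, i --> j ->
    vsq w i - vsq w j =
      2 * complex.Re (conjc (z i j) * flow w i j) - normc (z i j) ^+ 2 * ell w i j;
  ell_ge : forall i j, i --> j -> normc (flow w i j) ^+ 2 / vsq w i <= ell w i j;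
  inj_in : forall i, i != ord0 -> inj_set G i (sinj w i);
  v_ge : forall i, i != ord0 -> vmin G i <= vsq w i;
  vhat_le : forall i, i != ord0 -> vhat (sinj w) i <= vmax G i
}.

Definition objective (w : point R n) : R :=
  \sum_i cost G i (complex.Re (sinj w i)).

Definition optimal (w : point R n) : Prop :=
  feasible w /\ forall w', feasible w' -> objective w <= objective w'.

Definition socpm_exact : Prop :=
  forall w, optimal w ->
  forall i j, i --> j -> ell w i j = normc (flow w i j) ^+ 2 / vsq w i.

Definition u_vec (i : 'I_n.+1) : 'cV[R]_2 :=
  let zi := z i (parent (adj G) i) in
  \col_(k < 2) (if k == 0 then complex.Re zi else complex.Im zi).

Definition A_low (pbar qbar : 'I_n.+1 -> R) (i : 'I_n.+1) : 'M[R]_2 :=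
  1%:M - (2 / vmin G i) *:
    (u_vec i *m
     \row_(k < 2) (if k == 0 then Num.max (subtree_sum (adj G) pbar i) 0
                             else Num.max (subtree_sum (adj G) qbar i) 0)).

End SOCPm.

(* Main.v *)
Require Import Defs.
From mathcomp Require Import all_boot all_order all_algebra.
From mathcomp Require Import boolp classical_sets reals.
From mathcomp Require Import complex.
From mathcomp Require Import zify lra.

Set Implicit Arguments.
Unset Strict Implicit.
Unset Printing Implicit Defensive.

Import Order.TTheory GRing.Theory Num.Theory.
Local Open Scope ring_scope.
Local Open Scope classical_set_scope.

(** Suppose an optimal point has a line whose current exceeds the value forced by
    equality in the cone constraint.  Among those lines take the one leaving the bus [b]
    nearest to the root, so that all lines between [b] and the root are tight.
    The point is then changed along the root path of [b] only, keeping every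
    injection except the one at the substation: the current leaving [b] is
    lowered to its tight value, the power thereby saved is passed to the next
    line, whose current is reset to the tight value for its new flow, and so
    on up to the root (tighten_improves).

    Let [d] be the gain of flow on a line of the path, as a real vector
    (P-part, Q-part).  The tight current varies quadratically with the flow,
    and a line leaving [i] hands on the gain [d - (a . d) u_i], where [a] is the
    sum of the old and the new flow vector divided by [v_i].  Losses
    are nonnegative, so both flows are at most the lossless flow of the largest injections
    (flow_le_subtree_sum), and [v_i] is at least its lower bound; hence for
    [d >= 0] the gain handed on is [A_i d + beta u_i] with [beta >= 0], where
    [A_i] is the matrix [A_low] (sweep_positive_step).

    The hypothesis on products says that every [u_i], multiplied by the matrices of an
    initial stretch of the remaining way to the root, stays positive.  The vectors with
    this property at a given bus form a convex cone (sweep_positive) which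
    contains the first gain, a positive multiple of [u_b], and which
    the map [d |-> A_i d + beta u_i] sends into the cone of the next bus.
    So all gains are positive.

    Consequently the squared voltages can only rise: the rise across a line is
    [Re (conj z * (d + d'))] with [d] and [d'] the gains before and after the line.
    Higher voltages keep the cone constraints and the lower voltage bounds, and the upper
    bounds depend on the injections alone.  The substation injects strictly less, which
    contradicts optimality since its cost is strictly increasing. *)

(** * Rooted trees *)

(** Follow the second path backwards from the first bus where the first path meets it:
    two simple paths that leave [x] by different edges close a cycle. *)
Lemma acyclic_path_unique (T : eqType) (e : rel T) :
  symmetric e ->
  (forall c, cycle e c -> uniq c -> (size c < 3)%N) ->
  forall x p q, path e x p -> path e x q -> uniq (x :: p) -> uniq (x :: q) ->
    last x p = last x q -> p = q.
Proof.
move=> e_sym acyc x p; elim: p x => [|a p IHp] x [|b q] //.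
- by move=> _ _ _ /= /andP[xq _] lastq; rewrite lastq mem_last in xq.
- by move=> _ _ /= /andP[xp _] _ lastp; rewrite -lastp mem_last in xp.
move=> pathp pathq uniqp uniqq lastpq.
have [eab|nab] := eqVneq a b.
  subst b; congr (_ :: _); apply: (IHp a) => //.
  - by case/andP: pathp.
  - by case/andP: pathq.
  - by case/andP: uniqp.
  - by case/andP: uniqq.
(* [c] is the first vertex of [a :: p] on the other path. *)
have meet : has (mem (b :: q)) (a :: p).
  apply/hasP; exists (last a p); first exact: mem_last.
  by move: lastpq => /= ->; exact: mem_last.
have [c [p1 [p2 [Ep cq p1q]]]] : exists c p1 p2,
    [/\ a :: p = rcons p1 c ++ p2, c \in b :: q & ~~ has (mem (b :: q)) p1].
  by case: (split_find meet) => c p1 p2 cq p1q; exists c, p1, p2.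
have [q1 [q2 Eq]] : exists q1 q2, b :: q = q1 ++ c :: q2.
  by case/splitPr: cq => q1 q2; exists q1, q2.
have cyc : cycle e (x :: rcons p1 c ++ rev q1).
  rewrite /= rcons_path cat_path last_cat last_rcons.
  move: pathp; rewrite Ep cat_path => /andP[-> _] /=.
  move: pathq; rewrite Eq -cat_rcons cat_path => /andP[pathq _].
  have := pathq; rewrite -(eq_path (e := fun z => e^~ z)); last first.
    by move=> y z; rewrite /= e_sym.
  rewrite -rev_path last_rcons belast_rcons rev_cons rcons_path.
  by case/andP=> -> /=.
have uniqc : uniq (x :: rcons p1 c ++ rev q1).
  move: uniqp uniqq p1q; rewrite Ep Eq !cons_uniq !cat_uniq !mem_cat !negb_or.
  move=> /andP[/andP[xp1 _] /and3P[up1 _ _]].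
  move=> /andP[/andP[xq1 _] /and3P[uq1 /andP[cq1 _] _]] /hasPn p1q.
  rewrite xp1 mem_rev xq1 up1 rev_uniq uq1 !andbT /=.
  apply/hasPn => y; rewrite mem_rev mem_rcons inE negb_or => yq1.
  apply/andP; split.
    by apply: contraNneq cq1 => <-.
  by apply: contraL yq1 => /p1q /=; rewrite mem_cat negb_or => /andP[].
have := acyc _ cyc uniqc; rewrite /= size_cat size_rcons size_rev => lt3.
have p1nil : p1 = [::] by apply/nilP; rewrite /nilp; lia.
have q1nil : q1 = [::] by apply/nilP; rewrite /nilp; lia.
by case/eqP: nab; move: Ep Eq; rewrite p1nil q1nil /= => -[-> _] [-> _].
Qed.

Section Tree.
Variables (n : nat) (adj : rel 'I_n.+1).
Hypothesis tree : is_tree adj.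
Local Notation bus := 'I_n.+1.
Implicit Types i j k h : bus.
Local Notation rpath := (root_path adj).

Let root_path_specP i : root_path_spec adj i (behead (rpath i)).
Proof.
case: tree => _ _ conn _; rewrite /root_path /=.
case: xgetP => [p _ //|none].
have /connectP[p ep lastp] := conn i ord0.
case/shortenP: ep lastp => q eq uq _ lastq.
by exfalso; apply: (none q); split.
Qed.

Let root_pathE i p : root_path_spec adj i p -> rpath i = i :: p.
Proof.
case: tree => sym _ _ acyc [ep lastp up].
have [eq lastq uq] := root_path_specP i.
rewrite {1}/root_path; congr (_ :: _).
by apply: (acyclic_path_unique sym acyc eq ep) => //; rewrite lastq lastp.
Qed.

Lemma root_path_uniq i : uniq (rpath i).
Proof. by case: (root_path_specP i). Qed.

Lemma root_path0 : rpath ord0 = [:: ord0].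
Proof. exact: root_pathE. Qed.

(** A neighbour of [i] further along the root path of [i] would close a cycle,
    so it is the next bus on that path. *)
Lemma root_path_line i j : line adj i j -> rpath i = i :: rpath j.
Proof.
case: tree => sym irr _ acyc /andP[aij ji].
have [pathp lastp uniqp] := root_path_specP i.
have Ei : rpath i = i :: behead (rpath i) by [].
move: ji; rewrite Ei; move: (behead _) pathp lastp uniqp {Ei} => p pathp lastp uniqp.
rewrite inE => /orP[/eqP eij|jp]; first by rewrite eij irr in aij.
have [p1 [p2 Ep]] : exists p1 p2, p = p1 ++ j :: p2.
  by case/splitPr: jp => p1 p2; exists p1, p2.
have pathj : path adj i (rcons p1 j).
  by move: pathp; rewrite Ep -cat_rcons cat_path => /andP[].
have uniqj : uniq (i :: rcons p1 j).
  by move: uniqp; rewrite Ep -cat_rcons -cat_cons cat_uniq => /andP[].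
have cyc : cycle adj (i :: rcons p1 j).
  by rewrite /= rcons_path last_rcons pathj sym.
have := acyc _ cyc uniqj; rewrite /= size_rcons !ltnS leqn0 => /nilP p1nil.
subst p p1; congr (_ :: _); apply/esym/root_pathE; split.
- by case/andP: pathp.
- by [].
- by case/andP: uniqp.
Qed.

(** The bus after [i] on the root path of [i] is an end of a line leaving [i], so the
    default value of [parent] is taken at the root only. *)
Lemma line_parent i : i != ord0 -> line adj i (parent adj i).
Proof.
move=> i0; rewrite /parent; case: pickP => [//|noline].
have [pathp lastp uniqp] := root_path_specP i.
have Ei : rpath i = i :: behead (rpath i) by [].
case Ep: (behead (rpath i)) => [|j p].
  by move: lastp i0; rewrite Ep /= => ->; rewrite eqxx.
have := noline j; rewrite /line Ei Ep !inE eqxx orbT andbT => naij.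
by move: pathp; rewrite Ep /= naij.
Qed.

Lemma lineE i j : line adj i j = (i != ord0) && (j == parent adj i).
Proof.
apply/idP/andP => [lij|[i0 /eqP ->]]; last exact: line_parent.
have i0 : i != ord0.
  apply: contraTneq lij => ->; apply/negP => l0j.
  by have := root_path_line l0j; rewrite root_path0.
split=> //; have := root_path_line (line_parent i0).
by rewrite (root_path_line lij) => -[->].
Qed.

Lemma root_path_parent i :
  i != ord0 -> rpath i = i :: rpath (parent adj i).
Proof. by move=> /line_parent/root_path_line. Qed.

Lemma tree_ind (P : bus -> Prop) :
  P ord0 -> (forall i, i != ord0 -> P (parent adj i) -> P i) -> forall i, P i.
Proof.
move=> P0 Pi i; have [m] := ubnP (size (rpath i)).
elim: m i => // m IHm i lt_im.
have [->//|i0] := eqVneq i ord0; apply: Pi => //; apply: IHm.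
by move: lt_im; rewrite (root_path_parent i0).
Qed.

Lemma mem_root_path i : i \in rpath i.
Proof. exact: mem_head. Qed.

Lemma in_root_path k i :
  (i \in rpath k) = (i == k) || (k != ord0) && (i \in rpath (parent adj k)).
Proof.
have [->|k0] := eqVneq k ord0; first by rewrite root_path0 inE orbF.
by rewrite (root_path_parent k0) inE.
Qed.

Lemma notin_root_path_parent k : k != ord0 -> k \notin rpath (parent adj k).
Proof.
by move=> k0; have := root_path_uniq k; rewrite (root_path_parent k0) => /andP[].
Qed.

Lemma root_lines_neq0 i jk : jk \in root_lines adj i -> jk.1 != ord0.
Proof.
elim/tree_ind: i => [|i i0 IHi]; rewrite /root_lines ?root_path0 //.
by rewrite (root_path_parent i0) inE => /orP[/eqP -> //|/IHi].
Qed.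

Lemma depth0 : depth adj ord0 = 0%N.
Proof. by rewrite /depth root_path0. Qed.

Lemma depth_parent i : i != ord0 -> depth adj i = (depth adj (parent adj i)).+1.
Proof. by move=> i0; rewrite /depth (root_path_parent i0). Qed.

Lemma depth_le i : (depth adj i <= n)%N.
Proof.
have /card_uniqP card_path := root_path_uniq i.
have := max_card (mem (rpath i)); rewrite card_ord => le_n.
by rewrite /depth -ltnS -[(size _).-1.+1]card_path.
Qed.

Lemma root_path_cat i k : i \in rpath k -> exists p, rpath k = p ++ rpath i.
Proof.
elim/tree_ind: k => [|k k0 IHk]; rewrite in_root_path ?eqxx ?andbF ?orbF.
  by move=> /eqP ->; exists [::].
case/orP => [/eqP ->|]; first by exists [::].
by case/andP=> _ /IHk [p Ep]; exists (k :: p); rewrite root_path_parent // Ep.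
Qed.

Lemma depth_root_path i k : i \in rpath k -> (depth adj i <= depth adj k)%N.
Proof.
by case/root_path_cat => p; rewrite /depth => ->; rewrite size_cat /=; lia.
Qed.

Lemma path_bus_ancestor i k m : i \in rpath k -> (m <= depth adj i)%N ->
  path_bus adj k m = path_bus adj i m.
Proof.
case/root_path_cat => p Ep le_mi; rewrite /path_bus Ep rev_cat nth_cat size_rev.
by rewrite (_ : (m < _)%N).
Qed.

Lemma path_bus_depth i : path_bus adj i (depth adj i) = i.
Proof.
by rewrite /path_bus /depth nth_rev //= subnn.
Qed.

Lemma path_bus_root_path i k :
  i \in rpath k -> path_bus adj k (depth adj i) = i.
Proof. by move=> ik; rewrite (path_bus_ancestor ik) ?path_bus_depth. Qed.

(** A bus of maximal depth among those below [i] is a leaf. *)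
Lemma ex_leaf_below i :
  exists2 l, leaf adj l & i \in rpath l.
Proof.
have [l il max_l] :=
  @arg_maxnP _ i (fun l => i \in rpath l) (depth adj) (mem_root_path i).
exists l => //; apply/existsP => -[k]; rewrite lineE => /andP[k0 /eqP El].
have /max_l : i \in rpath k by rewrite in_root_path k0 -El il orbT.
by rewrite (depth_parent k0) -El /=; lia.
Qed.

Section Sums.
Variable V : nmodType.

(** A root path enters each of its buses, except its first one, from exactly
    one child.  Summing a constant is enough for the uses below, as there the
    summand depends on [h] at most through its parent. *)
Lemma sum_children_root_path (y : V) k i :
  \sum_(h | line adj h i && (h \in rpath k)) y =
  if (i \in rpath k) && (i != k) then y else 0.
Proof.
elim/tree_ind: k => [|k k0 IHk].
  rewrite root_path0 inE andbN big1 // => h /andP[].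
  by rewrite lineE inE => /andP[/negPf ->].
rewrite [i \in _]in_root_path k0 /= (bigID (pred1 k)) /=.
rewrite [X in _ + X](eq_bigl
  (fun h => line adj h i && (h \in rpath (parent adj k)))); last first.
  move=> h; rewrite (in_root_path k h) k0 /=.
  have [->|] := eqVneq h k; last by rewrite andbT.
  by rewrite (negPf (notin_root_path_parent k0)) !andbF.
rewrite IHk.
have [ik|nik] := eqVneq i k.
  subst i; rewrite /= (negPf (notin_root_path_parent k0)) addr0 big1 // => h.
  rewrite lineE => /andP[/andP[/andP[h0 /eqP hk] _] /eqP eh]; subst h.
  by move: (notin_root_path_parent k0); rewrite -hk mem_root_path.
rewrite /= andbT; have [->|ni] := eqVneq i (parent adj k).
  rewrite mem_root_path /= addr0 (big_pred1 k) // => h /=.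
  by have [->|] := eqVneq h k; rewrite ?andbF // line_parent // mem_root_path.
rewrite andbT big1 ?add0r // => h /andP[/andP[lhi _] /eqP eh].
by rewrite eh lineE (negPf ni) andbF in lhi.
Qed.

Lemma subtree_sum_children (x : bus -> V) i :
  subtree_sum adj x i = x i + \sum_(h | line adj h i) subtree_sum adj x h.
Proof.
rewrite /subtree_sum (exchange_big_dep predT) //=.
under [X in _ = _ + X]eq_bigr => k _ do rewrite sum_children_root_path.
rewrite -big_mkcond /= (bigD1 i) ?mem_root_path //=; congr (_ + _).
by apply: eq_bigl => k; rewrite eq_sym.
Qed.

End Sums.

(** Well founded because root paths are simple, which bounds depths by [n]. *)
Lemma leaf_ind (P : bus -> Prop) :
  (forall i, (forall h, line adj h i -> P h) -> P i) -> forall i, P i.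
Proof.
move=> Pi i; have [m] := ubnP (n - depth adj i).
elim: m i => // m IHm i lt_im; apply: Pi => h; rewrite lineE => /andP[h0 /eqP ei].
apply: IHm; move: lt_im (depth_le h); rewrite (depth_parent h0) -ei; lia.
Qed.

(** Nonnegative losses can only diminish what reaches the root, so a flow that satisfies
    power balance is bounded by the lossless flow. *)
Lemma flow_le_subtree_sum (F : numDomainType) (b x f loss : bus -> F) :
  (forall i, i != ord0 -> f i = x i + \sum_(h | line adj h i) (f h - loss h)) ->
  (forall i, i != ord0 -> 0 <= loss i) ->
  (forall i, i != ord0 -> x i <= b i) ->
  forall i, i != ord0 -> f i <= subtree_sum adj b i.
Proof.
move=> bal loss_ge0 le_xb; elim/leaf_ind => i IHi i0.
rewrite bal // subtree_sum_children lerD ?le_xb // ler_sum // => h hi.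
have h0 : h != ord0 by move: hi; rewrite lineE => /andP[].
by rewrite lerBlDr (le_trans (IHi h hi h0)) // lerDl loss_ge0.
Qed.

Lemma root_path_down (b : bus) (P : bus -> Prop) :
  P b -> (forall i, i \in rpath b -> i != ord0 -> P i -> P (parent adj i)) ->
  forall i, i \in rpath b -> P i.
Proof.
elim/tree_ind: b => [|b b0 IHb] Pb Pdown i; rewrite in_root_path ?eqxx ?b0 ?orbF.
  by move=> /eqP ->.
case/orP => [/eqP -> //|]; apply: IHb => [|j jb].
  exact: Pdown (mem_root_path b) _ Pb.
by apply: Pdown; rewrite in_root_path b0 jb orbT.
Qed.

Lemma parent_root_path i k :
  i \in rpath k -> i != ord0 -> parent adj i \in rpath k.
Proof.
case/root_path_cat => p -> i0.
by rewrite mem_cat in_root_path i0 mem_root_path !orbT.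
Qed.

Lemma root_child_on_path b : b != ord0 ->
  exists i, [/\ i \in rpath b, i != ord0 & parent adj i = ord0].
Proof.
elim/tree_ind: b => [/eqP//|c c0 IHc _].
have [pc0|pc0] := eqVneq (parent adj c) ord0.
  by exists c; rewrite mem_root_path.
have [i [ic i0 ei]] := IHc pc0; exists i; split=> //.
by rewrite in_root_path c0 ic orbT.
Qed.

(** Recursion along the root path of [b], from [b] towards the root: such a [g] exists
    because the parent map is injective on a root path. *)
Lemma root_path_sweep (T : Type) (b : bus) (x0 d : T) (step : bus -> T -> T) :
  exists g : bus -> T,
    [/\ g b = x0,
        forall i, i \notin rpath b -> g i = d
      & forall i, i \in rpath b -> i != ord0 ->
          g (parent adj i) = step i (g i)].
Proof.
elim/tree_ind: b x0 => [|b b0 IHb] x0.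
  exists (fun i => if i == ord0 then x0 else d).
  split=> [|i|i]; rewrite ?root_path0 ?inE ?eqxx //; first by move=> /negPf ->.
  by move=> ->.
have [g [gb goff gstep]] := IHb (step b x0).
exists (fun i => if i == b then x0 else g i); split=> [|i|i]; first by rewrite eqxx.
  by rewrite in_root_path b0 negb_or => /andP[/negPf -> /goff].
have nb j : j \in rpath (parent adj b) -> (j == b) = false.
  move=> jb; apply: contraNF (notin_root_path_parent b0) => /eqP ejb.
  by rewrite -{1}ejb.
rewrite in_root_path b0 => /orP[/eqP -> _|ib i0].
  by rewrite eqxx nb ?mem_root_path.
by rewrite !nb ?parent_root_path // gstep.
Qed.

End Tree.

(** * Real and imaginary parts *)

Section Components.
Variable R : realType.
Implicit Types (a c : R[i]) (x : R).
Local Notation normc := ComplexField.Normc.normc.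

Lemma cReD a c : complex.Re (a + c) = complex.Re a + complex.Re c.
Proof. by case: a c => [? ?] []. Qed.

Lemma cImD a c : complex.Im (a + c) = complex.Im a + complex.Im c.
Proof. by case: a c => [? ?] []. Qed.

Lemma cReN a : complex.Re (- a) = - complex.Re a.
Proof. by case: a. Qed.

Lemma cImN a : complex.Im (- a) = - complex.Im a.
Proof. by case: a. Qed.

Lemma cRe_sum I (r : seq I) (P : pred I) (f : I -> R[i]) :
  complex.Re (\sum_(i <- r | P i) f i) = \sum_(i <- r | P i) complex.Re (f i).
Proof. by apply: (big_morph _ cReD). Qed.

Lemma cIm_sum I (r : seq I) (P : pred I) (f : I -> R[i]) :
  complex.Im (\sum_(i <- r | P i) f i) = \sum_(i <- r | P i) complex.Im (f i).
Proof. by apply: (big_morph _ cImD). Qed.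

Lemma cReMr c x : complex.Re (c * x%:C%C) = complex.Re c * x.
Proof. by case: c => a b /=; rewrite mulr0 subr0. Qed.

Lemma cImMr c x : complex.Im (c * x%:C%C) = complex.Im c * x.
Proof. by case: c => a b /=; rewrite mulr0 add0r. Qed.

Lemma cRe_conjM a c :
  complex.Re (conjc a * c)
  = complex.Re a * complex.Re c + complex.Im a * complex.Im c.
Proof. by case: a c => [p q] [p' q'] /=; rewrite mulNr opprK. Qed.

Lemma sqr_normc c : normc c ^+ 2 = complex.Re c ^+ 2 + complex.Im c ^+ 2.
Proof. by case: c => p q /=; rewrite sqr_sqrtr // addr_ge0 // sqr_ge0. Qed.

Definition cE := (cReD, cImD, cReN, cImN, cReMr, cImMr, cRe_conjM, sqr_normc).

Definition col_of_complex c : 'cV[R]_2 :=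
  \col_(k < 2) (if k == 0 then complex.Re c else complex.Im c).

End Components.

(** * Gains carried towards the root *)

Section Exactness.
Variables (R : realType) (n : nat) (G : network R n).
Variables pbar qbar : 'I_n.+1 -> R.
Local Notation bus := 'I_n.+1.
Implicit Types i j h b l : bus.
Local Notation par := (parent (adj G)).
Local Notation rpath := (root_path (adj G)).
Local Notation lineG := (line (adj G)).
Local Notation depthG := (depth (adj G)).
Local Notation z i := (imp G i (par i)).
Local Notation normc := ComplexField.Normc.normc.
Local Notation A := (A_low G pbar qbar).
Local Notation Pmax i := (Num.max (subtree_sum (adj G) pbar i) 0).
Local Notation Qmax i := (Num.max (subtree_sum (adj G) qbar i) 0).
Local Notation bus_on := (path_bus (adj G)).
Let tree := adj_tree G.

Lemma mul_A_low i (d : R[i]) :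
  A i *m col_of_complex d
  = col_of_complex d
    - (2 / vmin G i * (Pmax i * complex.Re d + Qmax i * complex.Im d)) *: u_vec G i.
Proof.
rewrite /A_low mulmxBl mul1mx -scalemxAl -mulmxA.
set rw := (X in _ *m (X *m _)).
rewrite [rw *m _]mx11_scalar mul_mx_scalar scalerA; congr (_ - (_ * _) *: _).
by rewrite /rw !mxE !big_ord_recl big_ord0 !mxE /= addr0.
Qed.

(** The cone of gains arriving at bus [i] that remain positive under every
    further product of the matrices [A_low] on the way to the root.  The empty
    product, at [s = depth i + 1], makes the members themselves positive. *)
Definition sweep_positive i (w : 'cV[R]_2) : Prop :=
  forall s, (1 <= s)%N -> (s <= (depthG i).+1)%N -> forall k : 'I_2,
    0 < ((\prod_(s <= m < (depthG i).+1) A (bus_on i m)) *m w) k ord0.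

Lemma sweep_positive_gt0 i w :
  sweep_positive i w -> forall k, 0 < w k ord0.
Proof.
move=> /(_ (depthG i).+1 isT (leqnn _)) pos k.
by have := pos k; rewrite big_geq // mul1mx.
Qed.

Lemma sweep_positiveZ i a w :
  0 < a -> sweep_positive i w -> sweep_positive i (a *: w).
Proof.
move=> a0 pos s s1 sd k.
by rewrite -scalemxAr mxE mulr_gt0 // pos.
Qed.

Lemma sweep_positiveD i a w1 w2 :
  0 <= a -> sweep_positive i w1 -> sweep_positive i w2 ->
  sweep_positive i (w1 + a *: w2).
Proof.
move=> a0 pos1 pos2 s s1 sd k.
rewrite mulmxDr -scalemxAr mxE [X in _ + X]mxE ltr_pwDl ?pos1 //.
by rewrite mulr_ge0 // ltW // pos2.
Qed.

(** Only buses strictly between [i] and the root occur in the product, and these have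
    the same position on the root paths of [i] and of its parent. *)
Lemma sweep_prod_parent i s : i != ord0 ->
  \prod_(s <= m < depthG i) A (bus_on (par i) m)
  = \prod_(s <= m < depthG i) A (bus_on i m).
Proof.
move=> i0; apply: eq_big_nat => m /andP[_ lt_m]; congr (A _).
apply/esym/path_bus_ancestor => //.
  exact: (parent_root_path tree (mem_root_path _ _) i0).
by move: lt_m; rewrite (depth_parent tree i0).
Qed.

Lemma sweep_positive_parent i w : i != ord0 ->
  sweep_positive i w -> sweep_positive (par i) (A i *m w).
Proof.
move=> i0 pos s s1; rewrite -(depth_parent tree i0) => sd k.
have := pos s s1 (leqW sd) k; rewrite big_nat_recr //= -mulmxE -mulmxA.
by rewrite path_bus_depth sweep_prod_parent.
Qed.

Hypothesis products_gt0 : forall l : 'I_n.+1, leaf (adj G) l ->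
     forall s t : nat, (1 <= s)%N -> (s <= t)%N -> (t <= depth (adj G) l)%N ->
     forall k : 'I_2,
       0 < ((\prod_(s <= m < t) A_low G pbar qbar (path_bus (adj G) l m))
             *m u_vec G (path_bus (adj G) l t)) k ord0.

(** The hypothesis on products speaks of root paths of leaves; every bus lies on one. *)
Lemma sweep_positive_u i : i != ord0 -> sweep_positive (par i) (u_vec G i).
Proof.
move=> i0 s s1; rewrite -(depth_parent tree i0) => sd k.
have [l leafl il] := ex_leaf_below tree i.
have := products_gt0 leafl s1 sd (depth_root_path tree il) k.
rewrite (path_bus_root_path tree il) (sweep_prod_parent s i0).
rewrite (eq_big_nat _ _ (F2 := fun m => A (bus_on i m))) // => m /andP[_ lt_m].
by rewrite (path_bus_ancestor tree il (ltnW lt_m)).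
Qed.

(** The change of the tight current is [(a . d) / v] with [a] the sum of the
    old and the new flow vector, which the bounds put below the coefficient of
    [u_i] in [mul_A_low].  What is handed on is therefore [A_i d] plus a nonnegative
    multiple of [u_i], and both belong to the cone of the next bus. *)
Lemma sweep_positive_step i (S d : R[i]) (v : R) : i != ord0 ->
  vmin G i <= v ->
  complex.Re S <= subtree_sum (adj G) pbar i ->
  complex.Im S <= subtree_sum (adj G) qbar i ->
  complex.Re (S + d) <= subtree_sum (adj G) pbar i ->
  complex.Im (S + d) <= subtree_sum (adj G) qbar i ->
  sweep_positive i (col_of_complex d) ->
  sweep_positive (par i) (col_of_complex
    (d - z i * (normc (S + d) ^+ 2 / v - normc S ^+ 2 / v)%:C%C)).
Proof.
move=> i0 le_v leP leQ leP' leQ' pos.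
have d0 := sweep_positive_gt0 pos 0; have d1 := sweep_positive_gt0 pos 1.
rewrite !mxE /= in d0 d1.
set dl : R := normc _ ^+ 2 / v - _.
set g := 2 / vmin G i * (Pmax i * complex.Re d + Qmax i * complex.Im d).
(* [g] is the coefficient of [u_i] subtracted in [A_i d]. *)
have -> : col_of_complex (d - z i * dl%:C%C)
          = A i *m col_of_complex d + (g - dl) *: u_vec G i.
  rewrite mul_A_low -/g scalerBl addrA subrK.
  by apply/colP => k; rewrite !mxE; case: ifP; rewrite !cE mulrC.
apply: sweep_positiveD; last exact: sweep_positive_u.
  have v0 : 0 < vmin G i by exact: vmin_gt0.
  have vv : v^-1 <= (vmin G i)^-1 by rewrite lef_pV2 // posrE (lt_le_trans v0).
  have {}v0 : 0 < v by exact: lt_le_trans le_v.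
  have Pm0 : 0 <= Pmax i by rewrite le_max lexx orbT.
  have Qm0 : 0 <= Qmax i by rewrite le_max lexx orbT.
  have {}leP : complex.Re S <= Pmax i by rewrite le_max leP.
  have {}leQ : complex.Im S <= Qmax i by rewrite le_max leQ.
  have {}leP' : complex.Re (S + d) <= Pmax i by rewrite le_max leP'.
  have {}leQ' : complex.Im (S + d) <= Qmax i by rewrite le_max leQ'.
  rewrite subr_ge0 /dl -mulrBl /g.
  set h := Pmax i * complex.Re d + Qmax i * complex.Im d.
  have h0 : 0 <= h by rewrite addr_ge0 // mulr_ge0 // ltW.
  apply: (@le_trans _ _ (2 * h / v)); last first.
    by rewrite [2 / _ * h]mulrAC ler_wpM2l // mulr_ge0.
  rewrite ler_wpM2r ?invr_ge0 ?(ltW v0) // !sqr_normc /h.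
  move: leP' leQ'; rewrite !cE => leP' leQ'.
  by nra.
exact: sweep_positive_parent.
Qed.

(** * Tightening the path above a slack line *)

Hypothesis inj_bounded : forall i, i != ord0 ->
  inj_set G i `<=` [set s : R[i] | complex.Re s <= pbar i
                                 /\ complex.Im s <= qbar i].

Lemma flow_le_lossless (s S : bus -> R[i]) (L : bus -> R) :
  (forall i, i != ord0 ->
     S i = s i + \sum_(h | lineG h i) (S h - z h * (L h)%:C%C)) ->
  (forall i, i != ord0 -> 0 <= L i) ->
  (forall i, i != ord0 -> inj_set G i (s i)) ->
  forall i, i != ord0 -> complex.Re (S i) <= subtree_sum (adj G) pbar i
                      /\ complex.Im (S i) <= subtree_sum (adj G) qbar i.
Proof.
move=> bal L0 inj i i0; split.
  apply: (flow_le_subtree_sum tree (x := fun i => complex.Re (s i))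
    (loss := fun h => complex.Re (z h) * L h)
    (f := fun i => complex.Re (S i))) => // j j0.
  - rewrite {1}bal // cReD cRe_sum; congr (_ + _).
    by apply: eq_bigr => h _; rewrite !cE.
  - by rewrite mulr_ge0 ?L0 // ltW // r_gt0 // line_parent.
  - by have [] := inj_bounded j0 (inj j j0).
apply: (flow_le_subtree_sum tree (x := fun i => complex.Im (s i))
  (loss := fun h => complex.Im (z h) * L h)
  (f := fun i => complex.Im (S i))) => // j j0.
- rewrite {1}bal // cImD cIm_sum; congr (_ + _).
  by apply: eq_bigr => h _; rewrite !cE.
- by rewrite mulr_ge0 ?L0 // ltW // x_gt0 // line_parent.
- by have [] := inj_bounded j0 (inj j j0).
Qed.

Lemma balance_parent w : feasible G w -> forall i, i != ord0 ->
  flow w i (par i) = sinj w i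
    + \sum_(h | lineG h i) (flow w h (par h) - z h * (ell w h (par h))%:C%C).
Proof.
move=> fw i i0; rewrite (balance fw (line_parent tree i0)); congr (_ + _).
by apply: eq_bigr => h; rewrite (lineE tree) => /andP[_ /eqP ->].
Qed.

(** The gains [dS] are computed by one sweep along the root path of [b], using
    the old voltages in the tight currents.  The voltages are recomputed afterwards; as they
    rise, the currents chosen before still satisfy the cone constraints. *)
Lemma tighten_improves w b : feasible G w -> b != ord0 ->
  normc (flow w b (par b)) ^+ 2 / vsq w b < ell w b (par b) ->
  (forall i, i \in rpath b -> i != ord0 -> i != b ->
    ell w i (par i) = normc (flow w i (par i)) ^+ 2 / vsq w i) ->
  exists w', [/\ feasible G w',
    complex.Re (sinj w' ord0) < complex.Re (sinj w ord0)
    & forall i, i != ord0 -> sinj w' i = sinj w i].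
Proof.
move=> fw b0 slack tight.
have v_gt0 i : i != ord0 -> 0 < vsq w i.
  by move=> i0; apply: lt_le_trans (v_ge fw i0); exact: vmin_gt0.
pose S i := flow w i (par i); pose L i := ell w i (par i).
have S_ell i (i0 : i != ord0) := ell_ge fw (line_parent tree i0).
pose newL i (d : R[i]) : R := normc (S i + d) ^+ 2 / vsq w i.
have newL_ge0 i d : i != ord0 -> 0 <= newL i d.
  by move=> i0; rewrite divr_ge0 ?sqr_ge0 // ltW // v_gt0.
have L_ge0 i : i != ord0 -> 0 <= L i.
  move=> i0; apply: le_trans (S_ell i i0).
  by rewrite divr_ge0 ?sqr_ge0 // ltW // v_gt0.
(* The gain at [b] is zero: below [b] nothing changes. *)
have [dS [dSb dS_off dS_par]] := root_path_sweep tree b (0 : R[i]) 0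
  (fun i d => d - z i * (newL i d - L i)%:C%C).
pose on i := (i \in rpath b) && (i != ord0).
pose dL i : R := if on i then newL i (dS i) - L i else 0.
have dSdL h : h != ord0 ->
    dS h - z h * (dL h)%:C%C = if h \in rpath b then dS (par h) else 0.
  move=> h0; rewrite /dL /on h0 andbT; case: ifP => hb; first by rewrite dS_par.
  by rewrite dS_off ?hb // mulr0 subr0.
have sum_dS i : \sum_(h | lineG h i) (dS h - z h * (dL h)%:C%C) = dS i.
  rewrite (eq_bigr (fun h => if h \in rpath b then dS i else 0)); last first.
    by move=> h; rewrite (lineE tree) => /andP[h0 /eqP ei]; rewrite dSdL // -ei.
  rewrite -big_mkcondr /= (sum_children_root_path tree).
  case: ifPn => //; rewrite negb_and negbK => /orP[/dS_off ->//|/eqP ->].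
  by rewrite dSb.
have newLE i : i != ord0 -> L i + dL i = if i \in rpath b then newL i (dS i) else L i.
  by move=> i0; rewrite /dL /on i0 andbT; case: ifP; rewrite ?addr0 // addrC subrK.
have newL_ge0' i : i != ord0 -> 0 <= L i + dL i.
  by move=> i0; rewrite newLE //; case: ifP => _; [exact: newL_ge0|exact: L_ge0].
have bal' i : i != ord0 -> S i + dS i
    = sinj w i + \sum_(h | lineG h i) (S h + dS h - z h * (L h + dL h)%:C%C).
  move=> i0; rewrite {1}/S (balance_parent fw i0) -addrA -{1}(sum_dS i) -big_split /=.
  congr (_ + _); apply: eq_bigr => h _.
  by rewrite rmorphD /= mulrDr opprD addrACA.
(* Both flows obey power balance, so both are below the lossless flows. *)
have S_le := flow_le_lossless (balance_parent fw) L_ge0 (inj_in fw).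
have S_le' := flow_le_lossless bal' newL_ge0' (inj_in fw).
(* The first gain is the slack of the line leaving [b] times [u_b]. *)
have pos i : i \in rpath b -> i != ord0 ->
    sweep_positive (par i) (col_of_complex (dS (par i))).
  move: i; apply: (root_path_down tree (P := fun i => i != ord0 ->
    sweep_positive (par i) (col_of_complex (dS (par i))))).
    move=> _; rewrite dS_par ?mem_root_path // dSb /newL addr0.
    rewrite (_ : col_of_complex _ = (L b - normc (S b) ^+ 2 / vsq w b) *: u_vec G b).
      by apply: sweep_positiveZ; [rewrite subr_gt0|exact: sweep_positive_u].
    by apply/colP => k; rewrite !mxE; case: ifP; rewrite !cE sub0r -mulrN opprB mulrC.
  move=> i ib i0 pos_i pi0.
  have pib : par i \in rpath b by exact: parent_root_path.
  have pi_b : par i != b.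
    apply: contraTneq ib => eb; rewrite -eb; exact: notin_root_path_parent.
  rewrite (dS_par (par i)) // /newL /L tight //.
  apply: sweep_positive_step => //.
  - exact: v_ge fw _ pi0.
  - by have [] := S_le _ pi0.
  - by have [] := S_le _ pi0.
  - by have [] := S_le' _ pi0.
  - by have [] := S_le' _ pi0.
  - exact: pos_i.
have dS_pos i : i \in rpath b -> i != ord0 ->
    0 < complex.Re (dS (par i)) /\ 0 < complex.Im (dS (par i)).
  move=> ib i0; have p := sweep_positive_gt0 (pos i ib i0).
  by have := p 0; have := p 1; rewrite !mxE.
have dS_ge0 i : i \in rpath b -> 0 <= complex.Re (dS i) /\ 0 <= complex.Im (dS i).
  move: i; apply: (root_path_down tree); first by rewrite dSb.
  by move=> i ib i0 _; have [/ltW ? /ltW ?] := dS_pos i ib i0.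
have dS0 : 0 < complex.Re (dS ord0).
  have [i [ib i0 <-]] := root_child_on_path tree b0.
  by have [] := dS_pos i ib i0.
(* The voltage drop equations, summed along root paths, fix the voltage increments. *)
pose rise i : R := if i == ord0 then 0 else
  2 * complex.Re (conjc (z i) * dS i) - normc (z i) ^+ 2 * dL i.
have rise_ge0 i : 0 <= rise i.
  rewrite /rise; case: (eqVneq i ord0) => // i0.
  have [ib|nib] := boolP (i \in rpath b); last first.
    by rewrite dS_off // /dL /on (negPf nib) mulr0 /= !mulr0 subr0.
  (* With [z = r + x i] and [d'] the gain handed on, the rise is
     [r Re d + x Im d + r Re d' + x Im d']. *)
  have := dSdL i i0; rewrite ib => ed.
  have [a0 a1] := dS_ge0 i ib; have [] := dS_pos i ib i0; rewrite -ed !cE => e0 e1.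
  have zr := r_gt0 (line_parent tree i0); have zx := x_gt0 (line_parent tree i0).
  have k0 := mulr_ge0 (ltW zr) a0; have k1 := mulr_ge0 (ltW zx) a1.
  have k2 := mulr_ge0 (ltW zr) (ltW e0); have k3 := mulr_ge0 (ltW zx) (ltW e1).
  by lra.
pose dv i := \sum_(h <- rpath i) rise h.
have dv_ge0 i : 0 <= dv i by apply: sumr_ge0.
pose w' := Point (fun i => if i == ord0 then sinj w ord0 - dS ord0 else sinj w i)
  (fun i j => flow w i j + dS i) (fun i => vsq w i + dv i)
  (fun i j => ell w i j + dL i).
exists w'; split; last 2 first.
- by rewrite /= !cE ltrBlDr ltrDl.
- by move=> i /negPf i0; rewrite /= i0.
split.
- move=> i j; rewrite (lineE tree) => /andP[i0 /eqP ->] /=.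
  rewrite (negPf i0) bal' //; congr (_ + _); apply: eq_bigr => h.
  by rewrite (lineE tree) => /andP[_ /eqP ->].
- have -> : \sum_(h | lineG h ord0)
      (flow w' h ord0 - imp G h ord0 * (ell w' h ord0)%:C%C)
    = \sum_(h | lineG h ord0)
      (flow w h ord0 - imp G h ord0 * (ell w h ord0)%:C%C) + dS ord0.
    rewrite -(sum_dS ord0) -big_split /=; apply: eq_bigr => h.
    rewrite (lineE tree) => /andP[_ /eqP ->].
    by rewrite rmorphD /= mulrDr opprD addrACA.
  by rewrite /= [_ + dS _]addrC addrA subrK; exact: balance0 fw.
- by rewrite /= /dv root_path0 // big_seq1 /rise eqxx addr0 (v_sub fw).
- move=> i j; rewrite (lineE tree) => /andP[i0 /eqP ->] /=.
  rewrite /dv (root_path_parent tree i0) big_cons {1}/rise (negPf i0).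
  have := v_drop fw (line_parent tree i0).
  by rewrite !cE; lra.
- move=> i j; rewrite (lineE tree) => /andP[i0 /eqP ->] /=.
  rewrite -/(L i) -/(S i) newLE //.
  have v0 := v_gt0 _ i0.
  have le_v : (vsq w i + dv i)^-1 <= (vsq w i)^-1.
    by rewrite lef_pV2 ?posrE ?lerDl // ltr_pwDl.
  case: ifPn => ib; first by rewrite ler_wpM2l ?sqr_ge0.
  rewrite dS_off // addr0; apply: le_trans (S_ell i i0).
  by rewrite ler_wpM2l ?sqr_ge0.
- by move=> i i0; rewrite /= (negPf i0); exact: inj_in fw _ i0.
- by move=> i i0; rewrite /= ler_wpDr // (v_ge fw).
- move=> i i0; have := vhat_le fw i0; congr (_ <= _); congr (_ + 2 * _).
  apply: eq_big_seq => jk /(root_lines_neq0 tree) jk0.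
  congr (complex.Re (_ * _)); apply: eq_bigr => h jkh.
  rewrite /=; case: eqVneq jkh => // ->.
  by rewrite root_path0 // inE (negPf jk0).
Qed.

End Exactness.

(** * Exactness *)

Theorem theorem2 (R : realType) (n : nat) (n_gt0 : (0 < n)%N)
  (G : network R n) (pbar qbar : 'I_n.+1 -> R)
  (f0_increasing : forall a b : R, a < b -> cost G ord0 a < cost G ord0 b)
  (inj_bounded : forall i : 'I_n.+1, i != ord0 ->
     inj_set G i `<=` [set s : R[i] | complex.Re s <= pbar i
                                  /\ complex.Im s <= qbar i])
  (C1 : forall l : 'I_n.+1, leaf (adj G) l ->
     forall s t : nat, (1 <= s)%N -> (s <= t)%N -> (t <= depth (adj G) l)%N ->
     forall k : 'I_2,
       0 < ((\prod_(s <= m < t) A_low G pbar qbar (path_bus (adj G) l m))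
             *m u_vec G (path_bus (adj G) l t)) k ord0) :
  socpm_exact G.
Proof.
move=> w [fw opt] i j; have tree := adj_tree G.
rewrite (lineE tree) => /andP[i0 /eqP ->].
pose slack k := (k != ord0) && (ell w k (parent (adj G) k)
  != ComplexField.Normc.normc (flow w k (parent (adj G) k)) ^+ 2 / vsq w k).
apply/eqP/negPn/negP => slack_i.
have Si : slack i by rewrite /slack i0.
case: (arg_minnP (depth (adj G)) Si) => b /andP[b0 slack_b] min_b.
(* [b] has minimal depth among the buses with a slack line, so the lines above
   it are tight. *)
have [||w' [fw' less same]] := tighten_improves C1 inj_bounded fw b0.
- by rewrite lt_neqAle eq_sym slack_b (ell_ge fw) // line_parent.
- move=> k kb k0 nkb; apply/eqP/negPn/negP => slack_k.
  have le_bk := min_b k _; rewrite /slack k0 slack_k in le_bk.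
  have eq_depth : depth (adj G) k = depth (adj G) b.
    by apply/eqP; rewrite eqn_leq depth_root_path // le_bk.
  have := path_bus_root_path tree kb.
  by rewrite eq_depth path_bus_depth => eq_bk; rewrite eq_bk eqxx in nkb.
have := opt w' fw'; rewrite leNgt => /negP; apply.
rewrite /objective (bigD1 ord0) //= [ltRHS](bigD1 ord0) //=.
apply: ltr_leD; first exact: f0_increasing.
by apply: ler_sum => k k0; rewrite same.
Qed.
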